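(* Let $f:\mathbb{R}^n\to\mathbb{R}$ be a SOS-convex polynomial. For $i=1,\ldots,m$, let $\mathcal{V}_i\subset\mathbb{R}^{q_i}$ be a nonempty convex compact set and let $g_i:\mathbb{R}^n\times\mathbb{R}^{q_i}\to\mathbb{R}$ be a function such that $g_i(x,\cdot)$ is concave for each $x\in\mathbb{R}^n$, and $g_i(\cdot,v_i)$ is a SOS-convex polynomial with degree at most $d_i$ for each $v_i\in\mathcal{V}_i$. Suppose that $$\{x\in\mathbb{R}^n : g_i(x,v_i)<0\ \ \forall v_i\in\mathcal{V}_i,\ i=1,\ldots,m\}\neq\emptyset.$$ Let $k_0$ be the smallest even number such that $k_0\ge\max\{\deg f,\max_{1\le i\le m} d_i\}$. Then $$\inf\{f(x): g_i(x,v_i)\le 0\ \ \forall v_i\in\mathcal{V}_i,\ i=1,\ldots,m\}=\max_{\mu\in\mathbb{R},\,\lambda_i\ge 0,\,v_i\in\mathcal{V}_i}\Big\{\mu : f(\cdot)+\sum_{i=1}^m\lambda_i g_i(\cdot,v_i)-\mu\in\Sigma^2_{k_0}\Big\}.$$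
   Context: A matrix polynomial $M\in\mathbb{R}[x]^{n\times n}$ is a SOS matrix polynomial if $M(x)=H(x)H(x)^T$ for some matrix polynomial $H\in\mathbb{R}[x]^{n\times r}$, $r\in\mathbb{N}$. A real polynomial $f$ on $\mathbb{R}^n$ is SOS-convex if its Hessian $x\mapsto\nabla^2 f(x)$ is a SOS matrix polynomial. $\Sigma^2_d$ denotes the set of all real polynomials of degree at most $d$ that are sums of squares of real polynomials. Writing ''max'' means that the supremum is attained when it is finite; if no $(\mu,\lambda,v)$ is feasible, the value of the maximization problem is $-\infty$ by convention. *)

(* Defs.v *)
From HB Require Import structures.
From mathcomp Require Import all_boot all_order all_algebra.
From mathcomp Require Import all_classical all_reals all_analysis.
(* The notations of mpoly clash with those of mathcomp-analysis:
   [mpoly n R] is {mpoly R[n]} and [meval v p] is p.@[v]. *)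
From mathcomp Require Import -(notations) mpoly.

Set Implicit Arguments.
Unset Strict Implicit.
Unset Printing Implicit Defensive.

Import Order.TTheory GRing.Theory Num.Theory.
Import numFieldNormedType.Exports.

Local Open Scope classical_set_scope.
Local Open Scope ring_scope.

Section Polynomials.
Variables (R : realType) (n : nat).
Implicit Types (p : mpoly n R) (x : 'rV[R]_n).

(* [mmeasure mdeg p] (msize in mpoly) is 1 + the total degree, and 0 for p = 0;
   hence the zero polynomial gets degree 0 here. *)
Definition mpdeg p : nat := (mmeasure mdeg p).-1.

Definition mpeval p x : R := meval (x ord0) p.

Definition hessian p : 'M[mpoly n R]_n :=
  \matrix_(i, j) mderiv i (mderiv j p).

Definition sos_matrix k (M : 'M[mpoly n R]_k) : Prop :=
  exists (r : nat) (H : 'M[mpoly n R]_(k, r)), M = H *m H^T.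

Definition sos_convex p : Prop := sos_matrix (hessian p).

Definition Sigma2 (d : nat) : set (mpoly n R) :=
  [set p | (mpdeg p <= d)%N /\ exists s : seq (mpoly n R), p = \sum_(h <- s) h ^+ 2].

(* Since R is infinite, the polynomial p is determined by the function h. *)
Definition represents p (h : 'rV[R]_n -> R) : Prop := forall x, h x = mpeval p x.

End Polynomials.

Definition concave_function (R : realType) (E : lmodType R) (h : E -> R) : Prop :=
  convex_function (E := E) setT (fun v => - h v).

(* s is the "max" of A: the supremum in the extended reals (so -oo when A is
   empty), which has to be attained when it is finite. *)
Definition is_ereal_max (R : realType) (A : set R) (s : \bar R) : Prop :=
  s = ereal_sup (EFin @` A) /\ (forall a : R, s = a%:E -> A a).

(* Main.v *)
Require Import Defs.
From HB Require Import structures.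
From mathcomp Require Import all_boot all_order all_algebra.
From mathcomp Require Import all_classical all_reals all_analysis.
From mathcomp Require Import -(notations) mpoly.
From mathcomp Require Import polyrcf ring lra.

Set Implicit Arguments.
Unset Strict Implicit.
Unset Printing Implicit Defensive.

Import Order.TTheory GRing.Theory Num.Theory.
Import numFieldNormedType.Exports.

Local Open Scope classical_set_scope.
Local Open Scope ring_scope.

(** Weak duality is immediate: at a robustly feasible point the penalty terms
    are nonpositive and a sum of squares is nonnegative.  For the converse let
    a be a lower bound of f on the feasible set.  Two independent facts
    produce multipliers for which f + sum_i lambda_i g_i(., v_i) - a is a sum
    of squares.

    Convex duality ([robust_duality]): some lambda >= 0 and v_i in V_i make
    f + sum_i lambda_i g_i(., v_i) >= a everywhere.  The constraints on
    (lambda, v) are indexed by the points x; each is closed, and the Slater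
    point bounds every lambda_i, so that all of them live in the compact
    product of the [0, L_i] x V_i.  By compactness it suffices to satisfy,
    up to an arbitrary e > 0, finitely many of them ([finite_duality]).
    Concavity of the g_i in v makes the set of vectors dominated by
    (sum_i lambda_i g_i(x_k, v_i))_k a convex cone.  If the target vector were
    away from this cone, a separating functional would be a convex weight on
    the x_k, and the weighted mean of the x_k would be a feasible point with
    value of f below a.

    Exactness ([sos_convex_ge_sos]): an SOS-convex polynomial bounded below by
    a exceeds a by a sum of squares.  Restrict p to the segment from u to a
    generic x and use Taylor's formula with integral remainder: p equals its
    tangent at u plus the integral over [0, 1] of (1 - t) times the second
    derivative, which is a sum of squares of polynomials in t.  Integrating a
    square gives a quadratic form in its coefficients whose matrix is positive
    semidefinite, so the remainder is a sum of squares
    ([sos_convex_tangent]).  In particular p is convex, and when u minimizes p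
    the tangent is the constant p(u).  A minimizer exists
    ([sos_convex_attains_min]): along a recession direction p is a bounded
    univariate polynomial on a half line, hence constant, so that modulo the
    directions of constancy the sublevel sets are bounded.

    The Lagrangian is SOS-convex, as SOS-convex polynomials form a convex cone,
    and k0 bounds its degree. *)

(** * Polynomials along lines *)

(** Constants and variables generate the polynomial ring, so a property
    stable under sums and products need only be checked on them. *)
Lemma mpoly_ring_ind (R : comNzRingType) n (P : mpoly n R -> Prop) :
  (forall c, P (mpolyC n c)) -> (forall i, P (mpolyX R (mnm1 i))) ->
  (forall p q, P p -> P q -> P (p + q)) ->
  (forall p q, P p -> P q -> P (p * q)) -> forall p, P p.
Proof.
move=> PC PX PD PM; apply: mpolyind; first by rewrite -mpolyC0.
have P1 : P 1 by rewrite -mpolyC1; exact: PC.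
move=> c m p _ _ Pp; apply: PD => //; rewrite -mul_mpolyC; apply: (PM) => //.
rewrite mpolyXE_id; apply: (big_ind P) => // i _.
by elim: (m i) => [|k IH]; rewrite ?expr0 // exprS; apply: PM.
Qed.

Section Line.
Variables (R S : comNzRingType) (n : nat) (c : {rmorphism R -> S}).
Variables (a b : 'I_n -> S).

(** The substitution X_i := a_i + b_i t, with t the variable of {poly S}.
    Allowing S to be a polynomial ring lets the same formulas serve for a
    numerical line and for the segment from u to the generic point. *)
Definition line_poly : mpoly n R -> {poly S} :=
  mmap (polyC \o c) (fun i => (a i)%:P + b i *: 'X).

HB.instance Definition _ := GRing.RMorphism.on line_poly.

Lemma line_polyC r : line_poly (mpolyC n r) = (c r)%:P.
Proof. by rewrite /line_poly mmapC. Qed.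

Lemma line_polyX i : line_poly (mpolyX R (mnm1 i)) = (a i)%:P + b i *: 'X.
Proof. by rewrite /line_poly mmapX mmap1U. Qed.

Lemma horner_line_poly p t :
  (line_poly p).[t] = mmap c (fun i => a i + b i * t) p.
Proof.
elim/mpoly_ring_ind: p => [r|i|p q IHp IHq|p q IHp IHq].
- by rewrite line_polyC hornerC mmapC.
- by rewrite line_polyX mmapX mmap1U !hornerE.
- by rewrite !rmorphD hornerD IHp IHq.
- by rewrite !rmorphM hornerM IHp IHq.
Qed.

(** The chain rule: both sides are derivations along the substitution that
    agree on constants and variables. *)
Lemma deriv_line_poly p :
  (line_poly p)^`() = \sum_i b i *: line_poly (mderiv i p).
Proof.
elim/mpoly_ring_ind: p => [r|i|p q IHp IHq|p q IHp IHq].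
- rewrite line_polyC derivC big1 // => i _.
  by rewrite mderivC rmorph0 scaler0.
- rewrite line_polyX derivD derivC add0r derivZ derivX (bigD1 i) //=.
  rewrite big1 => [|j ji].
    rewrite mderivX mnm1E eqxx scale1r.
    rewrite (_ : mnm_sub _ _ = mnm0) ?mpolyX0 ?rmorph1 ?addr0 //.
    by apply/mnmP => k; rewrite mnmBE mnm0E subnn.
  by rewrite mderivX mnm1E eq_sym (negbTE ji) scale0r rmorph0 scaler0.
- rewrite rmorphD derivD IHp IHq -big_split /=; apply: eq_bigr => i _.
  by rewrite mderivD rmorphD scalerDr.
- rewrite rmorphM derivM IHp IHq mulr_suml mulr_sumr -big_split /=.
  apply: eq_bigr => i _.
  by rewrite mderivM rmorphD !rmorphM scalerDr scalerAl scalerAr.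
Qed.

End Line.

(** * Real univariate polynomials *)

(** If the derivative at 0 were nonzero, it would keep its sign near 0, and
    the mean value theorem would give a smaller value on one side of 0. *)
Lemma poly_min_deriv (R : rcfType) (q : {poly R}) :
  (forall t, q.[0] <= q.[t]) -> q^`().[0] = 0.
Proof.
move=> qmin; apply/eqP; apply: contraT => q'0.
have e_gt0 : 0 < `|q^`().[0]| by rewrite normr_gt0.
have [d d_gt0 dP] := @poly_cont R 0 q^`() _ e_gt0.
(* A step against the sign of the derivative, shorter than d. *)
pose t := if 0 < q^`().[0] then - (d / 2%:R) else d / 2%:R.
have t0 : t != 0.
  by rewrite /t; case: ifP => _; rewrite ?oppr_eq0 mulf_neq0 ?gt_eqF ?invr_gt0.
have qt := qmin t.
suff [x /andP[xt xd] qx] : exists2 x, (x * t >= 0) && (`|x| < d) &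
    q.[t] - q.[0] = q^`().[x] * t.
  have := dP x; rewrite subr0 => /(_ xd).
  move: qt; rewrite -subr_ge0 qx /t; case: ltrP => h.
    by rewrite (gtr0_norm h) ltr_norml; nra.
  by rewrite (ler0_norm h) ltr_norml; nra.
rewrite /t; case: ifP => _.
  have [|x x_in qx] := @poly_mvt R (- (d / 2%:R)) 0 q; first lra.
  move: x_in; rewrite in_itv /= => /andP[x1 x2].
  exists x; last by lra.
  by apply/andP; split; [nra|rewrite ltr_norml; lra].
have [|x x_in qx] := @poly_mvt R 0 (d / 2%:R) q; first lra.
move: x_in; rewrite in_itv /= => /andP[x1 x2].
exists x; last by rewrite qx subr0.
by apply/andP; split; [nra|rewrite ltr_norml; lra].
Qed.

Lemma poly_unbounded (R : rcfType) (q : {poly R}) M :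
  (1 < size q)%N -> 0 < lead_coef q -> exists2 t, 0 <= t & M < q.[t].
Proof.
move=> sq lq.
have lqM : lead_coef (q - M%:P) = lead_coef q.
  by rewrite lead_coefDl // size_polyN (leq_ltn_trans (size_polyC_leq1 _)).
have [|t0 t0P] := @poly_pinfty_gt_lc R (q - M%:P); first by rewrite lqM.
exists (Num.max 0 t0); first by rewrite le_max lexx.
have := t0P (Num.max 0 t0); rewrite le_max lexx orbT lqM !hornerE => /(_ isT).
by rewrite -subr_gt0; exact: lt_le_trans.
Qed.

(** A nonconstant polynomial is unbounded on a half line, by the sign of its
    leading coefficient. *)
Lemma poly_bounded_const (R : rcfType) (q : {poly R}) A B :
  (forall t, 0 <= t -> A <= q.[t] <= B) -> forall t, q.[t] = q.[0].
Proof.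
move=> qAB; have [sq|sq] := leqP (size q) 1.
  by move=> t; rewrite (size1_polyC sq) !hornerC.
have : lead_coef q != 0 by rewrite lead_coef_eq0 -size_poly_gt0 ltnW.
rewrite neq_lt => /orP[lq|lq].
  have [||t t0] := @poly_unbounded _ (- q) (- A);
    rewrite ?size_polyN ?lead_coefN ?oppr_gt0 //.
  by rewrite hornerN ltrN2 ltNge; case/andP: (qAB t t0) => ->.
have [t t0] := @poly_unbounded _ q B sq lq.
by rewrite ltNge; case/andP: (qAB t t0) => _ ->.
Qed.

Lemma poly_le0_at0 (R : rcfType) (r : {poly R}) :
  (forall t, 0 < t <= 1 -> r.[t] <= 0) -> r.[0] <= 0.
Proof.
move=> r_le0; rewrite leNgt; apply/negP => r_gt0.
have [e e_gt0 eP] := @poly_cont R 0 r _ r_gt0.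
pose t := Num.min 1 (e / 2%:R).
have t_gt0 : 0 < t by rewrite lt_min ltr01 divr_gt0.
have := r_le0 t; rewrite t_gt0 ge_min lexx => /(_ isT) rt.
have : `|r.[t] - r.[0]| < r.[0].
  apply: eP; rewrite subr0 gtr0_norm // /t.
  have : Num.min 1 (e / 2%:R) <= e / 2%:R by rewrite ge_min lexx orbT.
  lra.
by rewrite ltr_norml; lra.
Qed.

(** * Positive semidefinite matrices and integrals of squares *)

(** Cholesky factorization, by completing the square in the first variable:
    with a the corner entry and v the rest of its row, either a = 0, which
    forces v = 0, or the Schur complement D - v^T v / a is again positive
    semidefinite. *)
Lemma psd_factor (R : rcfType) n (A : 'M[R]_n) :
  A^T = A -> (forall x : 'rV[R]_n, 0 <= (x *m A *m x^T) 0 0) ->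
  exists r (B : 'M[R]_(n, r)), A = B *m B^T.
Proof.
elim: n A => [|n IH] A symA psdA.
  by exists 0%N, 0; apply/matrixP; case.
rewrite -[n.+1]/(1 + n)%N in A symA psdA *.
pose a : R := A 0 0; pose v : 'rV[R]_n := ursubmx A.
pose D : 'M[R]_n := drsubmx A.
have defA : A = block_mx a%:M v v^T D.
  have -> : a%:M = ulsubmx A.
    by rewrite [RHS]mx11_scalar !mxE /a; congr (A _ _)%:M; apply/val_inj.
  have -> : v^T = dlsubmx A by rewrite /v trmx_ursub symA.
  by rewrite submxK.
have symD : D^T = D by rewrite /D trmx_drsub symA.
clearbody a v D.
have DE (X Y : 'M[R]_1) : (X + Y) 0 0 = X 0 0 + Y 0 0 by rewrite mxE.
have ZE c (X : 'M[R]_1) : (c *: X) 0 0 = c * X 0 0 by rewrite mxE.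
have NE (X : 'M[R]_1) : (- X) 0 0 = - X 0 0 by rewrite mxE.
have SE c : (c%:M : 'M[R]_1) 0 0 = c by rewrite mxE eqxx mulr1n.
have psdE (s : R) (y : 'rV[R]_n) :
    0 <= s ^+ 2 * a + 2%:R * s * (v *m y^T) 0 0 + (y *m D *m y^T) 0 0.
  have := psdA (row_mx s%:M y).
  rewrite defA mul_row_block tr_row_mx mul_row_col !mul_scalar_mx.
  rewrite tr_scalar_mx mul_mx_scalar mulmxDl scalerDr -scalemxAl.
  rewrite !(DE, ZE, SE).
  have -> : (y *m v^T) 0 0 = (v *m y^T) 0 0.
    by rewrite -[y *m _]trmxK mxE trmx_mul trmxK.
  by move=> h; apply: le_trans h _; rewrite le_eqVlt; apply/orP; left; apply/eqP; ring.
have a_ge0 : 0 <= a.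
  by have := psdE 1 0; rewrite trmx0 !mulmx0 !mxE; lra.
have [a0|a_neq0] := eqVneq a 0.
  have v0 : v = 0.
    apply/eqP; apply: contraT => v_neq0.
    pose w := (v *m v^T) 0 0; pose z := (v *m D *m v^T) 0 0.
    have w_gt0 : 0 < w.
      have [j vj] := rV0Pn _ v_neq0.
      rewrite /w mxE; under eq_bigr do rewrite mxE -expr2.
      rewrite (bigD1 j) //= ltr_pwDl //; last first.
        by apply: sumr_ge0 => k _; rewrite sqr_ge0.
      by rewrite exprn_even_gt0.
    (* The form at (s, v) is 2 s w + z; this s gives it the value -1. *)
    have := psdE (- ((z + 1) / (2%:R * w))) v; rewrite a0 -/w -/z.
    rewrite mulr0 add0r (_ : _ + z = -1); first by rewrite ler0N1.
    by field; rewrite gt_eqF.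
  have [y|r [B DB]] := IH D symD.
    by have := psdE 0 y; rewrite expr0n /= mul0r mulr0 mul0r !add0r.
  exists r, (col_mx 0 B); rewrite defA v0 a0 tr_col_mx mul_col_row.
  by rewrite !trmx0 !mul0mx mulmx0 DB raddf0.
have a_gt0 : 0 < a by rewrite lt_def a_neq0.
have [||r [B DB]] := IH (D - a^-1 *: (v^T *m v)).
- by rewrite linearB /= linearZ /= trmx_mul trmxK symD.
- move=> y; have [t tE] : exists t : R, v *m y^T = t%:M.
    by exists ((v *m y^T) 0 0); rewrite [LHS]mx11_scalar.
  (* The s that minimizes the form at (s, y). *)
  have := psdE (- (t / a)) y; rewrite tE SE.
  rewrite mulmxBr mulmxBl -scalemxAr -scalemxAl !mulmxA.
  have -> : y *m v^T *m v *m y^T = (t ^+ 2)%:M.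
    have tE' : y *m v^T = t%:M by rewrite -[LHS]trmxK trmx_mul trmxK tE tr_scalar_mx.
    by rewrite tE' -mulmxA tE -scalar_mxM expr2.
  rewrite scale_scalar_mx !(DE, NE, SE).
  move=> h; apply: le_trans h _; rewrite le_eqVlt; apply/orP; left; apply/eqP.
  by field.
exists (1 + r)%N, (block_mx (Num.sqrt a)%:M 0 ((Num.sqrt a)^-1 *: v^T) B).
rewrite tr_block_mx mulmx_block defA.
have sa : Num.sqrt a != 0 by rewrite sqrtr_eq0 -ltNge.
rewrite trmx0 !mulmx0 !mul0mx !addr0 tr_scalar_mx -scalar_mxM -expr2 sqr_sqrtr //.
rewrite linearZ /= trmxK mul_scalar_mx mul_mx_scalar -!scalemxAr -!scalemxAl.
rewrite !scalerA mulfV ?mulVf ?mulfV // !scale1r -DB; congr block_mx.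
by rewrite -invfM -expr2 sqr_sqrtr // addrC subrK.
Qed.

Section IntegralRemainder.
Variables (R : realType) (S : comNzRingType) (c : {rmorphism R -> S}).

Definition rem_weight (k : nat) : R := (k.+1 * k.+2)%N%:R^-1.

(** The image under c of the remainder functional
    Q |-> int_0^1 (1 - t) Q(t) dt, since (1 - t) t^k has integral
    1 / ((k + 1) (k + 2)); the bound N only has to exceed the degree of Q. *)
Definition rem_int N (Q : {poly S}) : S := \sum_(k < N) c (rem_weight k) * Q`_k.

Lemma rem_int_sum N (I : Type) (r : seq I) (F : I -> {poly S}) :
  rem_int N (\sum_(i <- r) F i) = \sum_(i <- r) rem_int N (F i).
Proof.
rewrite /rem_int exchange_big /=; apply: eq_bigr => k _.
by rewrite coef_sum mulr_sumr.
Qed.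

(** The weights cancel the factors (k + 2) (k + 1) of the second derivative. *)
Lemma taylor_rem_int N (P : {poly S}) : (size P <= N.+2)%N ->
  P.[1] = P.[0] + P^`().[0] + rem_int N P^`()^`().
Proof.
move=> sP; rewrite (horner_coef_wide 1 sP) !horner_coef0 coef_deriv mulr1n.
rewrite !big_ord_recl /= !expr1n !mulr1 addrA; congr (_ + _).
apply: eq_bigr => k _; rewrite expr1n mulr1 !coef_deriv -mulrnA.
rewrite -mulr_natr mulrCA -(rmorph_nat c) -rmorphM /rem_weight.
by rewrite [(k.+2 * _)%N]mulnC mulVf ?pnatr_eq0 // rmorph1 mulr1.
Qed.

Lemma rem_int_sqr M (Q : {poly S}) : (size Q <= M)%N ->
  rem_int (M + M) (Q ^+ 2) =
  \sum_(k < M) \sum_(l < M) c (rem_weight (k + l)) * (Q`_k * Q`_l).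
Proof.
move=> sQ; have {1}-> : Q ^+ 2 =
    \sum_(k < M) \sum_(l < M) (Q`_k * Q`_l) *: 'X^(k + l).
  have QE : Q = \sum_(k < M) Q`_k *: 'X^k.
    rewrite -poly_def; apply/polyP => i; rewrite coef_poly.
    by case: ltnP => // /(leq_trans sQ) /(nth_default 0) ->.
  rewrite {1}QE expr2 mulr_suml; apply: eq_bigr => k _.
  rewrite mulr_sumr; apply: eq_bigr => l _.
  by rewrite -scalerAl -scalerAr scalerA -exprD.
rewrite rem_int_sum; apply: eq_bigr => k _; rewrite rem_int_sum; apply: eq_bigr => l _.
have klM : (k + l < M + M)%N by rewrite -addnS leq_add // ltnW.
rewrite /rem_int (bigD1 (Ordinal klM)) //= big1 => [|i ikl].
  by rewrite coefZ coefXn eqxx mulr1 addr0.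
by rewrite coefZ coefXn -val_eqE /= in ikl *; rewrite (negbTE ikl) !mulr0.
Qed.

End IntegralRemainder.

(** Positivity of the integral, obtained without integration: a polynomial P
    with P'' = q^2 and P(0) = P'(0) = 0 has P(1) >= 0 by applying the mean
    value theorem twice. *)
Lemma rem_int_sqr_ge0 (R : realType) N (q : {poly R}) :
  (size (q ^+ 2) <= N)%N -> 0 <= rem_int idfun N (q ^+ 2).
Proof.
move=> sq2.
(* The double antiderivative of q^2. *)
pose P := \poly_(i < N.+2)
  (if i is k.+2 then rem_weight R k * (q ^+ 2)`_k else 0).
have P2 : P^`()^`() = q ^+ 2.
  apply/polyP => k; rewrite !coef_deriv coef_poly !ltnS.
  case: ltnP => kN; last by rewrite !mul0rn nth_default // (leq_trans sq2).
  rewrite -mulrnA -mulr_natr mulrAC /rem_weight [(k.+2 * _)%N]mulnC.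
  by rewrite mulVf ?mul1r // pnatr_eq0.
have := @taylor_rem_int R R idfun N P (size_poly _ _).
rewrite P2 !horner_coef0 coef_deriv /P !coef_poly /= mul0rn !add0r => <-.
have [x x01 /eqP] := @poly_mvt R 0 1 P ltr01.
rewrite subr0 mulr1 subr_eq => /eqP ->.
have x0 : 0 < x by rewrite (itvP x01).
have [y _ /eqP] := @poly_mvt R 0 x P^`() x0.
rewrite subr_eq => /eqP ->; rewrite P2 !horner_coef0 coef_deriv !coef_poly /=.
by rewrite mul0rn !addr0 subr0 mulr_ge0 ?(ltW x0) // hornerM -expr2 sqr_ge0.
Qed.

(** The integral of a square is a quadratic form in its coefficients.  Its
    matrix is real and positive semidefinite because integrals of real squares
    are nonnegative; the resulting factorization holds for coefficients in any
    ring over R. *)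
Lemma rem_int_sqr_sos (R : realType) M : exists r (B : 'M[R]_(M, r)),
  forall (S : comNzRingType) (c : {rmorphism R -> S}) (Q : {poly S}),
    (size Q <= M)%N -> rem_int c (M + M) (Q ^+ 2) =
    \sum_(j < r) (\sum_(k < M) c (B k j) * Q`_k) ^+ 2.
Proof.
pose A : 'M[R]_M := \matrix_(k, l) rem_weight R (k + l).
have [||r [B AB]] := @psd_factor R M A.
- by apply/matrixP => k l; rewrite !mxE addnC.
- move=> x; pose q : {poly R} := \poly_(k < M) oapp (x 0) 0 (insub k).
  have sq : (size q <= M)%N by exact: size_poly.
  have := @rem_int_sqr_ge0 R (M + M) q.
  have -> : (size (q ^+ 2) <= M + M)%N.
    by rewrite (leq_trans (size_polyMleq _ _)) // (leq_trans (leq_pred _)) // leq_add.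
  rewrite rem_int_sqr // => /(_ isT); congr (_ <= _).
  rewrite mxE exchange_big /=; apply: eq_bigr => l _; rewrite mxE mulr_suml.
  apply: eq_bigr => k _; rewrite !mxE !coef_poly !ltn_ord !valK /=.
  by rewrite mulrCA mulrA.
exists r, B => S c Q sQ; rewrite rem_int_sqr //.
transitivity (\sum_(k < M) \sum_(l < M) \sum_(j < r)
    (c (B k j) * Q`_k) * (c (B l j) * Q`_l)).
  apply: eq_bigr => k _; apply: eq_bigr => l _.
  have -> : rem_weight R (k + l) = (B *m B^T) k l by rewrite -AB mxE.
  rewrite mxE rmorph_sum mulr_suml; apply: eq_bigr => j _.
  by rewrite mxE rmorphM /=; ring.
rewrite [RHS](eq_bigr (fun j => \sum_(k < M) \sum_(l < M)
    (c (B k j) * Q`_k) * (c (B l j) * Q`_l))); last first.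
  by move=> j _; rewrite expr2 mulr_suml; apply: eq_bigr => k _; rewrite mulr_sumr.
rewrite exchange_big /=; rewrite [RHS]exchange_big [LHS]exchange_big /=.
by apply: eq_bigr => k _; rewrite exchange_big.
Qed.

(** * Convex functions *)

Definition convex_fun (R : realType) (E : lmodType R) (h : E -> R) :=
  forall x y t, 0 <= t <= 1 -> h (t *: x + (1 - t) *: y) <= t * h x + (1 - t) * h y.

Lemma convex_fun_jensen (R : realType) (E : lmodType R) (h : E -> R) N
    (mu : 'I_N -> R) (X : 'I_N -> E) : convex_fun h ->
  (forall k, 0 <= mu k) -> \sum_k mu k = 1 ->
  h (\sum_k mu k *: X k) <= \sum_k mu k * h (X k).
Proof.
move=> ch; elim: N mu X => [|N IH] mu X mu_ge0 mu1.
  by move: mu1; rewrite big_ord0 => /eqP; rewrite eq_sym oner_eq0.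
move: mu1; rewrite !big_ord_recl /=; set s := \sum_(k < N) _ => mu1.
have s_ge0 : 0 <= s by apply: sumr_ge0.
have [s0|s_neq0] := eqVneq s 0.
  have mu0 k : mu (lift ord0 k) = 0 by apply: (psumr_eq0P _ s0).
  rewrite big1 ?[X in _ <= _ + X]big1 => [|k _|k _]; rewrite ?mu0 ?mul0r ?scale0r //.
  by move: mu1; rewrite s0 !addr0 => ->; rewrite scale1r mul1r.
have sE : s = 1 - mu ord0 by rewrite -mu1 addrC addKr.
have := IH (fun k => mu (lift ord0 k) / s) (fun k => X (lift ord0 k)).
rewrite -mulr_suml mulfV //.
move=> /(_ (fun k => divr_ge0 (mu_ge0 _) s_ge0) erefl) IHs.
have mu01 : 0 <= mu ord0 <= 1 by rewrite mu_ge0 -subr_ge0 -sE.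
have := ch (X ord0) (\sum_(k < N) (mu (lift ord0 k) / s) *: X (lift ord0 k)) _ mu01.
rewrite -sE.
have -> : s *: (\sum_(k < N) (mu (lift ord0 k) / s) *: X (lift ord0 k)) =
    \sum_(k < N) mu (lift ord0 k) *: X (lift ord0 k).
  by rewrite scaler_sumr; apply: eq_bigr => k _; rewrite scalerA mulrC divfK.
move=> /le_trans; apply; rewrite lerD2l.
apply: le_trans (ler_wpM2l s_ge0 IHs) _; rewrite mulr_sumr le_eqVlt; apply/orP; left.
by apply/eqP; apply: eq_bigr => k _; rewrite mulrA [s * _]mulrC divfK.
Qed.

Lemma rV_coord_le_norm (R : realType) q (w : 'rV[R]_q) j : `|w 0 j| <= `|w|.
Proof. by rewrite [leRHS]mx_normrE; exact: (le_bigmax _ _ (0, j)). Qed.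

Section ConvexContinuous.
Variables (R : realType) (q : nat) (h : 'rV[R]_q -> R).
Hypothesis ch : convex_fun h.

(** Write x + w as the mean of the points x + q w_j e_j: Jensen reduces the
    bound to the coordinate axes, and q |w| <= 1 keeps these points in the
    segments [x - e_j, x] and [x, x + e_j], where convexity applies. *)
Lemma convex_fun_upper_lipschitz x : exists2 K, 0 <= K &
  forall w, q%:R * `|w| <= 1 -> h (x + w) <= h x + K * `|w|.
Proof.
pose M (j : 'I_q) := `|h (x + delta_mx 0 j) - h x| + `|h (x - delta_mx 0 j) - h x|.
exists (\sum_j M j); first by apply: sumr_ge0 => j _; apply: addr_ge0.
have axis j s : `|s| <= 1 -> h (x + s *: delta_mx 0 j) <= h x + `|s| * M j.
  move=> s1; have s01 : 0 <= `|s| <= 1 by rewrite normr_ge0.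
  pose e : 'rV[R]_q := Num.sg s *: delta_mx 0 j.
  have := ch (x + e) x s01.
  have -> : `|s| *: (x + e) + (1 - `|s|) *: x = x + s *: delta_mx 0 j.
    rewrite scalerDr addrAC -scalerDl addrC [`|s| + _]addrC subrK scale1r addrC.
    by rewrite /e scalerA mulrC -numEsg.
  move=> /le_trans; apply.
  suff : h (x + e) - h x <= M j by move=> /(ler_wpM2l (normr_ge0 s)); lra.
  rewrite /e /M; case: sgrP => _.
  - by rewrite scale0r addr0 subrr addr_ge0.
  - by rewrite scale1r (le_trans (ler_norm _)) // lerDl.
  - by rewrite scaleN1r (le_trans (ler_norm _)) // lerDr.
move=> w qw; have [q0|q_gt0] := posnP q.
  have -> : w = 0 by apply/rowP => -[k kq]; exfalso; rewrite q0 in kq.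
  by rewrite normr0 mulr0 !addr0.
have qR : 0 < q%:R :> R by rewrite ltr0n.
have wj j : `|w 0 j| <= `|w| by exact: rV_coord_le_norm.
have -> : x + w = \sum_j q%:R^-1 *: (x + (q%:R * w 0 j) *: delta_mx 0 j).
  rewrite -scaler_sumr big_split /= scalerDr.
  rewrite (_ : \sum_(j < q) x = q%:R *: x); last first.
    by rewrite sumr_const card_ord scaler_nat.
  rewrite scalerA.
  rewrite mulVf ?gt_eqF // scale1r scaler_sumr; congr (_ + _).
  rewrite {1}(row_sum_delta w); apply: eq_bigr => j _.
  by rewrite scalerA mulrA mulVf ?mul1r // gt_eqF.
apply: le_trans (convex_fun_jensen _ ch _ _) _ => [j||].
- by rewrite invr_ge0 ltW.
- by rewrite sumr_const card_ord -[LHS]mulr_natr mulVf // gt_eqF.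
apply: (@le_trans _ _ (\sum_(j < q) (q%:R^-1 * h x + `|w| * M j))).
  apply: ler_sum => j _.
  have qwj : `|q%:R * w 0 j| <= 1.
    by rewrite normrM (gtr0_norm qR) (le_trans _ qw) // ler_wpM2l // ltW.
  apply: (@le_trans _ _ (q%:R^-1 * (h x + `|q%:R * w 0 j| * M j))).
    by rewrite ler_wpM2l ?axis // invr_ge0 ltW.
  rewrite mulrDr lerD2l normrM (gtr0_norm qR) !mulrA mulVf ?gt_eqF // mul1r.
  by rewrite ler_wpM2r // addr_ge0.
rewrite big_split /= sumr_const card_ord -mulr_sumr -[_ *+ q]mulr_natr mulrAC.
by rewrite mulVf ?gt_eqF // mul1r mulrC.
Qed.

(** The lower bound follows from the upper one at the reflected point, as x is
    the midpoint of y and 2 x - y. *)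
Lemma convex_fun_continuous : continuous h.
Proof.
move=> x; have [K K_ge0 KP] := convex_fun_upper_lipschitz x.
apply/(@cvgrPdist_le R R^o _ (nbhs x) _ h (h x)) => /= e e_gt0.
have K1_gt0 : 0 < K + 1 by rewrite ltr_wpDl.
have q1_gt0 : 0 < q%:R + 1 :> R by rewrite ltr_wpDl.
pose d := Num.min (e / (K + 1)) (q%:R + 1)^-1.
have d_gt0 : 0 < d by rewrite lt_min divr_gt0 // invr_gt0.
near=> y.
have yx : `|y - x| <= d.
  rewrite distrC; near: y; apply: (@cvgr_dist_le _ _ _ (nbhs x) _ id x) => //.
have de : d <= e / (K + 1) by rewrite ge_min lexx.
have dq : d <= (q%:R + 1)^-1 by rewrite ge_min lexx orbT.
have Ke : K * `|y - x| <= e.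
  have : (K + 1) * `|y - x| <= e by rewrite mulrC -ler_pdivlMr // (le_trans yx).
  by have := normr_ge0 (y - x); lra.
have qw : q%:R * `|y - x| <= 1.
  have : (q%:R + 1) * `|y - x| <= 1.
    by rewrite mulrC -ler_pdivlMr // mul1r (le_trans yx).
  by have := normr_ge0 (y - x); lra.
have := KP (y - x) qw; rewrite addrC subrK => up.
have := KP (x - y); rewrite distrC => /(_ qw) lo.
have half : 0 <= (2%:R^-1 : R) <= 1 by lra.
have := ch y (x + (x - y)) half.
have -> : 2%:R^-1 *: y + (1 - 2%:R^-1) *: (x + (x - y)) = x.
  rewrite (_ : 1 - 2%:R^-1 = 2%:R^-1 :> R); last by lra.
  rewrite -scalerDr.
  have -> : y + (x + (x - y)) = x + x by rewrite addrCA [y + _]addrC subrK.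
  by rewrite -[x + x]mulr2n -[x *+ 2]scaler_nat scalerA mulVf ?scale1r.
by rewrite ler_norml; lra.
Unshelve. all: by end_near. Qed.

End ConvexContinuous.

(** * SOS-convex polynomials *)

Section SosConvex.
Variables (R : realType) (n : nat).
Implicit Types (p : mpoly n R) (u x : 'rV[R]_n).

Definition tangent p u : mpoly n R := mpolyC n (mpeval p u) +
  \sum_i (mpolyX R (mnm1 i) - mpolyC n (u 0 i)) * mpolyC n (mpeval (mderiv i p) u).

(** Taylor's formula for p on the segment from u to the generic point X: the
    second derivative of t |-> p(u + t (X - u)) is
    sum_{i,k} (X_i - u_i) (X_k - u_k) (d_i d_k p)(u + t (X - u)), which the
    factorization H H^T of the Hessian turns into a sum of squares, one for
    each column of H. *)
Lemma sos_convex_tangent p u : sos_convex p ->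
  exists s : seq (mpoly n R), p = tangent p u + \sum_(h <- s) h ^+ 2.
Proof.
case=> r [H hessE].
pose a i : mpoly n R := mpolyC n (u 0 i).
pose b i : mpoly n R := mpolyX R (mnm1 i) - a i.
pose L := line_poly (@mpolyC n R) a b.
have L1 g : (L g).[1] = g.
  rewrite /L horner_line_poly; elim/mpoly_ring_ind: g => [c|i|g h Hg Hh|g h Hg Hh].
  - by rewrite mmapC.
  - by rewrite mmapX mmap1U mulr1 /b addrC subrK.
  - by rewrite rmorphD /= Hg Hh.
  - by rewrite rmorphM /= Hg Hh.
have L0 g : (L g).[0] = mpolyC n (mpeval g u).
  rewrite /L horner_line_poly /mpeval.
  elim/mpoly_ring_ind: g => [c|i|g h Hg Hh|g h Hg Hh].
  - by rewrite mmapC mevalC.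
  - by rewrite mmapX mmap1U mulr0 addr0 mevalXU.
  - by rewrite rmorphD /= Hg Hh mevalD mpolyCD.
  - by rewrite rmorphM /= Hg Hh mevalM mpolyCM.
pose Q j : {poly mpoly n R} := \sum_i b i *: L (H i j).
have L2 : (L p)^`()^`() = \sum_(j < r) Q j ^+ 2.
  rewrite /L deriv_line_poly raddf_sum -/L /=.
  transitivity (\sum_(i < n) \sum_(k < n) \sum_(j < r)
      (b i *: L (H i j)) * (b k *: L (H k j))).
    apply: eq_bigr => i _; rewrite derivZ /L deriv_line_poly -/L scaler_sumr.
    apply: eq_bigr => k _; rewrite -mpoly.mderiv_comm.
    have -> : mderiv i (mderiv k p) = (H *m H^T) i k by rewrite -hessE mxE.
    rewrite mxE /L rmorph_sum /= -/L !scaler_sumr; apply: eq_bigr => j _.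
    by rewrite mxE /L rmorphM /= scalerA -scalerAl -scalerAr scalerA.
  rewrite (eq_bigr (fun i => \sum_(j < r) \sum_(k < n)
      (b i *: L (H i j)) * (b k *: L (H k j)))) => [|i _]; last exact: exchange_big.
  rewrite exchange_big /=; apply: eq_bigr => j _.
  by rewrite expr2 mulr_suml; apply: eq_bigr => i _; rewrite mulr_sumr.
(* A common size bound for p on the segment and all the Q j. *)
pose M := maxn (size (L p)) (\max_(j < r) size (Q j)).
have [k [B BE]] := rem_int_sqr_sos R M.
exists [seq \sum_(l < M) mpolyC n (B l i) * (Q j)`_l
         | j <- index_enum 'I_r, i <- index_enum 'I_k].
rewrite big_allpairs_dep /=.
have sM : (size (L p) <= (M + M).+2)%N.
  by rewrite (leq_trans (leq_maxl _ _ : _ <= M)%N) // -addnS -addnS leq_addr.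
rewrite -{1}(L1 p) (taylor_rem_int (@mpolyC n R) sM) L0 L2 rem_int_sum.
congr (_ + _ + _).
  rewrite /L deriv_line_poly -/L horner_sum; apply: eq_bigr => i _.
  by rewrite hornerZ L0.
apply: eq_bigr => j _; rewrite BE //.
by rewrite (leq_trans _ (leq_maxr _ _)) // (leq_bigmax j).
Qed.

Lemma mpeval_tangent p u x : mpeval (tangent p u) x =
  mpeval p u + \sum_i (x 0 i - u 0 i) * mpeval (mderiv i p) u.
Proof.
rewrite /mpeval /tangent mevalD mevalC rmorph_sum /=; congr (_ + _).
by apply: eq_bigr => i _; rewrite mevalM mevalB mevalXU !mevalC.
Qed.

Lemma mpeval_sos_ge0 (s : seq (mpoly n R)) x : 0 <= mpeval (\sum_(h <- s) h ^+ 2) x.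
Proof.
rewrite /mpeval rmorph_sum /=; apply: sumr_ge0 => h _.
by rewrite rmorphXn sqr_ge0.
Qed.

Lemma sos_convex_above_tangent p u x : sos_convex p ->
  mpeval (tangent p u) x <= mpeval p x.
Proof.
case/(sos_convex_tangent u) => s {2}->.
by rewrite /mpeval mevalD lerDl mpeval_sos_ge0.
Qed.

(** Each value is bounded below by the tangent at the convex combination,
    and the tangent is affine. *)
Lemma sos_convex_convex_fun p : sos_convex p ->
  convex_fun (mpeval p : 'rV[R]_n -> R).
Proof.
move=> cp x y t /andP[t0 t1]; set u := t *: x + (1 - t) *: y.
have -> : mpeval p u =
    t * mpeval (tangent p u) x + (1 - t) * mpeval (tangent p u) y.
  rewrite !mpeval_tangent.
  suff : t * (\sum_i (x 0 i - u 0 i) * mpeval (mderiv i p) u) +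
      (1 - t) * (\sum_i (y 0 i - u 0 i) * mpeval (mderiv i p) u) = 0 by lra.
  rewrite !mulr_sumr -big_split big1 // => i _.
  by rewrite /u !mxE /=; ring.
by rewrite lerD // ler_wpM2l ?subr_ge0 // sos_convex_above_tangent.
Qed.

Definition segment_poly p x (v : 'rV[R]_n) : {poly R} :=
  line_poly idfun (x 0) (v 0) p.

Lemma horner_segment_poly p x v t : (segment_poly p x v).[t] = mpeval p (x + t *: v).
Proof.
rewrite /segment_poly horner_line_poly /mpeval; apply: meval_eq => i.
by rewrite !mxE mulrC.
Qed.

(** At a minimizer the gradient vanishes, so the tangent is constant. *)
Lemma sos_convex_min_sos p u : sos_convex p -> (forall x, mpeval p u <= mpeval p x) ->
  exists s : seq (mpoly n R), p - mpolyC n (mpeval p u) = \sum_(h <- s) h ^+ 2.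
Proof.
move=> cp umin; have [s ps] := sos_convex_tangent u cp; exists s.
rewrite {1}ps /tangent big1 => [|i _]; first by rewrite addr0 addrAC subrr add0r.
suff -> : mpeval (mderiv i p) u = 0 by rewrite mpolyC0 mulr0.
have /poly_min_deriv : forall t, (segment_poly p u (delta_mx 0 i)).[0] <=
    (segment_poly p u (delta_mx 0 i)).[t].
  by move=> t; rewrite !horner_segment_poly scale0r addr0.
rewrite /segment_poly deriv_line_poly horner_sum (bigD1 i) //= big1 => [|j ji].
  rewrite mxE !eqxx scale1r addr0 => <-.
  by rewrite -/(segment_poly _ _ _) horner_segment_poly scale0r addr0.
by rewrite mxE (negbTE ji) andbF scale0r horner0.
Qed.

End SosConvex.

Section SosConvexCone.
Variables (R : realType) (n : nat).
Implicit Types (p q : mpoly n R).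

Lemma sos_convexD p q : sos_convex p -> sos_convex q -> sos_convex (p + q).
Proof.
move=> [r [H pH]] [s [K qK]]; exists (r + s)%N, (row_mx H K).
rewrite tr_row_mx mul_row_col -pH -qK.
by apply/matrixP => i j; rewrite !mxE !mderivD.
Qed.

Lemma sos_convexZ (c : R) p : 0 <= c -> sos_convex p -> sos_convex (c *: p).
Proof.
move=> c0 [r [H pH]]; exists r, (mpolyC n (Num.sqrt c) *: H).
rewrite linearZ /= -scalemxAl -scalemxAr scalerA -pH -mpolyCM -expr2 sqr_sqrtr //.
by apply/matrixP => i j; rewrite !mxE !mderivZ mul_mpolyC.
Qed.

Lemma sos_convex_comb p (I : finType) (c : I -> R) (P : I -> mpoly n R) :
  sos_convex p -> (forall i, 0 <= c i) -> (forall i, sos_convex (P i)) ->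
  sos_convex (p + \sum_i c i *: P i).
Proof.
move=> cp c0 cP; elim/big_rec: _ => [|i s _ cs]; first by rewrite addr0.
by rewrite addrCA; apply: sos_convexD => //; apply: sos_convexZ.
Qed.

Lemma mpdeg_leP p k : (mpdeg p <= k)%N = (mmeasure (@mdeg n) p <= k.+1)%N.
Proof. by rewrite /mpdeg; case: mmeasure. Qed.

Lemma mpdegD p q k : (mpdeg p <= k)%N -> (mpdeg q <= k)%N -> (mpdeg (p + q)%R <= k)%N.
Proof.
rewrite !mpdeg_leP => pk qk.
apply: leq_trans (mmeasureD_le _ _ _) _.
by rewrite geq_max pk.
Qed.

Lemma mpdegZ c p k : (mpdeg p <= k)%N -> (mpdeg (c *: p) <= k)%N.
Proof. by rewrite !mpdeg_leP; apply: leq_trans; exact: mmeasureZ_le. Qed.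

Lemma mpdegC (c : R) k : (mpdeg (mpolyC n c) <= k)%N.
Proof. by rewrite mpdeg_leP mmeasureC; case: (_ != _). Qed.

Lemma mpdeg_comb p (I : finType) (c : I -> R) (P : I -> mpoly n R) k :
  (mpdeg p <= k)%N -> (forall i, mpdeg (P i) <= k)%N ->
  (mpdeg (p + \sum_i c i *: P i)%R <= k)%N.
Proof.
move=> pk Pk; elim/big_rec: _ => [|i s _ sk]; first by rewrite addr0.
by rewrite addrCA; apply: mpdegD => //; exact: mpdegZ.
Qed.

End SosConvexCone.

(** * Topological preliminaries *)

Lemma closed_le (T : topologicalType) (R : realType) (f g : T -> R) :
  continuous f -> continuous g -> closed [set x | f x <= g x].
Proof.
move=> cf cg.
have -> : [set x | f x <= g x] = (fun x => g x - f x) @^-1` [set r | 0 <= r].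
  by apply/seteqP; split => x /=; rewrite subr_ge0.
apply: closed_comp; last exact: closed_ge.
by move=> x _; apply: cvgB; [exact: cg|exact: cf].
Qed.

Lemma continuous_affine (R : realType) (V : normedModType R) (x : V) (t : R) :
  continuous (fun d => x + t *: d).
Proof.
by move=> d; apply: (@cvgD R V V (nbhs d) _ (cst x) (fun d => t *: d));
  [exact: cvg_cst|exact: scaler_continuous].
Qed.

Lemma continuous_norm_shift (R : realType) (V : normedModType R) (x : V) :
  continuous (fun d : V => `|d + x|).
Proof.
move=> d; apply: cvg_norm.
by apply: (@cvgD R V V (nbhs d) _ id (cst x)); [exact: cvg_id|exact: cvg_cst].
Qed.

Lemma continuous_sum (R : realType) (T : topologicalType) (I : finType)
    (F : I -> T -> R) :
  (forall i, continuous (F i)) -> continuous (fun x => \sum_i F i x).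
Proof.
by move=> cF; apply: continuous_big => //; exact: add_continuous.
Qed.

Lemma closure_stable (T : topologicalType) (W : set T) (f : T -> T) :
  continuous f -> (forall w, W w -> W (f w)) ->
  forall w, closure W w -> closure W (f w).
Proof.
move=> cf Wf w clw B Bfw; have [y [Wy By]] := clw _ (cf w _ Bfw).
by exists (f y); split; [exact: Wf|exact: By].
Qed.

(** * Attainment of the minimum *)

Section Attainment.
Variables (R : realType) (n : nat).
Implicit Types (p : mpoly n R) (x d l z : 'rV[R]_n).

Lemma mpeval_continuous p : continuous (mpeval p : 'rV[R]_n -> R).
Proof.
rewrite /mpeval; elim/mpoly_ring_ind: p => [c|i|p q cp cq|p q cp cq] x.
- rewrite (_ : (fun _ => _) = cst c); first exact: cst_continuous.
  by apply/funext => y; rewrite mevalC.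
- rewrite (_ : (fun _ => _) = fun y : 'rV[R]_n => y ord0 i).
    exact: coord_continuous.
  by apply/funext => y; rewrite mevalXU.
- rewrite (_ : (fun _ => _) = (fun y : 'rV[R]_n => meval (y ord0) p) \+
    (fun y : 'rV[R]_n => meval (y ord0) q)); first exact: (continuousD (cp x) (cq x)).
  by apply/funext => y; rewrite mevalD.
- rewrite (_ : (fun _ => _) = (fun y : 'rV[R]_n => meval (y ord0) p) \*
    (fun y : 'rV[R]_n => meval (y ord0) q)); first exact: (continuousM (cp x) (cq x)).
  by apply/funext => y; rewrite mevalM.
Qed.

Definition const_dirs p : set 'rV[R]_n :=
  [set d | forall x t, mpeval p (x + t *: d) = mpeval p x].

(** Convexity first transports the bound from the ray t d to every parallel
    ray x + s d: this point is the limit, as e tends to 0, of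
    e ((s / e) d) + (1 - e) x, whose value is at most
    e p(0) + (1 - e) p(x).  So p is bounded on each such ray, hence constant
    on it, and even on the whole line. *)
Lemma sos_convex_recession p a d : sos_convex p -> (forall x, a <= mpeval p x) ->
  (forall t, 0 <= t -> mpeval p (t *: d) <= mpeval p 0) -> const_dirs p d.
Proof.
move=> cp pa dec x t.
suff le_x s : 0 <= s -> mpeval p (x + s *: d) <= mpeval p x.
  have := @poly_bounded_const _ (segment_poly p x d) a (mpeval p x).
  move=> /(_ _ t); rewrite !horner_segment_poly scale0r addr0; apply.
  by move=> s s0; rewrite horner_segment_poly pa le_x.
move=> s0.
(* As a polynomial in e: value at the convex combination minus its bound. *)
pose r := segment_poly p (x + s *: d) (- x) -
  ((mpeval p x)%:P + 'X * (mpeval p 0 - mpeval p x)%:P).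
have rE e : r.[e] = mpeval p (x + s *: d + e *: - x) -
    (mpeval p x + e * (mpeval p 0 - mpeval p x)).
  by rewrite /r !hornerE horner_segment_poly.
have := @poly_le0_at0 _ r; rewrite rE scale0r mul0r !addr0 subr_le0; apply => e e01.
rewrite rE subr_le0; have e0 : e != 0 by lra.
have -> : x + s *: d + e *: - x = e *: ((s / e) *: d) + (1 - e) *: x.
  by rewrite scalerA mulrC divfK // scalerN scalerBl scale1r addrAC addrC addrA.
have e01' : 0 <= e <= 1 by lra.
apply: le_trans (sos_convex_convex_fun cp _ _ e01') _.
have : mpeval p ((s / e) *: d) <= mpeval p 0 by apply: dec; rewrite divr_ge0 //; lra.
have e_ge0 : 0 <= e by lra.
by move=> /(ler_wpM2l e_ge0); lra.
Qed.

Lemma const_dirs_closed p : closed (const_dirs p).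
Proof.
have -> : const_dirs p = \bigcap_(xt in [set: 'rV[R]_n * R])
   ([set d | mpeval p (xt.1 + xt.2 *: d) <= mpeval p xt.1] `&`
    [set d | mpeval p xt.1 <= mpeval p (xt.1 + xt.2 *: d)]).
  apply/seteqP; split => d /= dP.
    by move=> [x t] _ /=; rewrite dP.
  move=> x t; apply/eqP; rewrite eq_le.
  by have [/= -> ->] := dP (x, t) I.
apply: closed_bigI => -[x t] _ /=.
have c1 : continuous (fun d : 'rV[R]_n => mpeval p (x + t *: d)).
  move=> d; apply: (@continuous_comp _ _ _ (fun d => x + t *: d) (mpeval p)).
    exact: continuous_affine.
  exact: mpeval_continuous.
by apply: closedI; apply: closed_le => // y; exact: cst_continuous.
Qed.

(** Selects representatives modulo L by least norm, which plays the role of an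
    orthogonal complement but makes sense for any norm. *)
Definition reduced_mod (L : set 'rV[R]_n) z := forall l, L l -> `|z| <= `|z + l|.

Lemma ball_compact r : compact [set x : 'rV[R]_n | `|x| <= r].
Proof.
apply: bounded_closed_compact.
  by exists r; split; [exact: num_real|move=> M rM x /= /le_trans -> //; exact: ltW].
by apply: closed_le; [exact: norm_continuous|exact: cst_continuous].
Qed.

Lemma const_dirs_reduced p x : exists2 z, reduced_mod (const_dirs p) z &
  mpeval p z = mpeval p x.
Proof.
have L0 : const_dirs p 0 by move=> y t; rewrite scaler0 addr0.
have LD l l' : const_dirs p l -> const_dirs p l' -> const_dirs p (l + l').
  by move=> Ll Ll' y t; rewrite scalerDr addrA Ll' Ll.
pose A := const_dirs p `&` [set l | `|l + x| <= `|x|].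
have [|||l /[!inE] -[Ll lx] lmin] := @EVT_min_rV R n (fun l => `|l + x|) A.
- by exists 0; split => //=; rewrite add0r.
- apply: (@subclosed_compact _ _ [set l | `|l| <= `|x| + `|x|]); last 1 first.
  + move=> l [_ /= lx]; rewrite -[l](addrK x) (le_trans (ler_normB _ _)) //.
    by rewrite lerD2r.
  + apply: closedI; first exact: const_dirs_closed.
    by apply: closed_le; [exact: continuous_norm_shift|exact: cst_continuous].
  + exact: ball_compact.
- by apply: continuous_subspaceT; exact: continuous_norm_shift.
exists (l + x); last by have := Ll x 1; rewrite scale1r addrC.
move=> l' Ll'; have [le_x|/ltW gt_x] := lerP `|l + x + l'| `|x|; last first.
  exact: le_trans gt_x.
rewrite addrAC; apply: lmin; rewrite inE; split; first exact: LD.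
by rewrite /= addrAC.
Qed.

(** Otherwise normalize reduced points of unbounded norm in the sublevel set.
    A cluster point e of the normalized sequence is still reduced and of norm
    1, and p(t e) <= p(0) for all t >= 0.  So e is a direction of constancy,
    and being reduced yields |e| <= |e - e| = 0. *)
Lemma sos_convex_sublevel_bounded p a : sos_convex p -> (forall x, a <= mpeval p x) ->
  exists N, forall z, reduced_mod (const_dirs p) z -> mpeval p z <= mpeval p 0 ->
    `|z| <= N.
Proof.
move=> cp pa; apply: contrapT => nex.
have /choice[z zP] : forall k : nat, exists z, [/\ reduced_mod (const_dirs p) z,
    mpeval p z <= mpeval p 0 & k%:R < `|z|].
  move=> k; apply: contrapT => nz; apply: nex; exists k%:R => z rz pz.
  by rewrite leNgt; apply/negP => kz; apply: nz; exists z.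
have z_gt0 k : 0 < `|z k| by have [_ _] := zP k; apply: le_lt_trans.
pose d k := `|z k|^-1 *: z k.
have d1 k : `|d k| = 1.
  by rewrite normrZ gtr0_norm ?invr_gt0 // mulVf // gt_eqF.
have dk t k : 0 <= t <= k%:R -> mpeval p (t *: d k) <= mpeval p 0.
  move=> /andP[t0 tk]; have [_ pz kz] := zP k.
  have e01 : 0 <= t / `|z k| <= 1.
    by rewrite divr_ge0 //= ler_pdivrMr // mul1r (le_trans tk) // ltW.
  have := sos_convex_convex_fun cp (z k) 0 e01.
  rewrite scaler0 addr0 /d scalerA => /le_trans -> //.
  by case/andP: e01; nra.
have rd k l : const_dirs p l -> `|d k| <= `|d k + l|.
  move=> Ll; have [rz _ _] := zP k.
  have -> : d k + l = `|z k|^-1 *: (z k + `|z k| *: l).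
    by rewrite scalerDr scalerA mulVf ?scale1r // gt_eqF.
  rewrite !normrZ ler_wpM2l // rz // => x t.
  by rewrite scalerA Ll.
have dS : (d @ \oo) [set x : 'rV[R]_n | `|x| <= 1].
  by exists 0%N => // k _; rewrite /= d1.
have [e [_ ecl]] := @ball_compact 1 (d @ \oo) _ dS.
have eC (C : set 'rV[R]_n) : closed C -> (\forall k \near \oo, C (d k)) -> C e.
  by move=> cC dC; apply: cC => B Be; exact: ecl.
have eL : const_dirs p e.
  apply: sos_convex_recession cp pa _ => t t0.
  apply: (eC [set d | mpeval p (t *: d) <= mpeval p 0]).
    apply: closed_le => y; last exact: cst_continuous.
    apply: (@continuous_comp _ _ _ (fun d => t *: d) (mpeval p)).
      exact: scaler_continuous.
    exact: mpeval_continuous.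
  near=> k; apply: dk; rewrite t0 /=; near: k.
  exact: nbhs_infty_ger.
have e1 : 1 <= `|e|.
  apply: (eC [set d | 1 <= `|d|]).
    by apply: closed_le; [exact: cst_continuous|exact: norm_continuous].
  by apply: nearW => k; rewrite /= d1.
have : `|e| <= `|e + - e|.
  apply: (eC [set d | `|d| <= `|d + - e|]).
    by apply: closed_le; [exact: norm_continuous|exact: continuous_norm_shift].
  apply: nearW => k /=; apply: rd => x t.
  by rewrite scalerN -scaleNr eL.
by rewrite subrr normr0 leNgt (lt_le_trans ltr01).
Unshelve. all: by end_near. Qed.

Lemma sos_convex_attains_min p a : sos_convex p -> (forall x, a <= mpeval p x) ->
  exists u, forall x, mpeval p u <= mpeval p x.
Proof.
move=> cp pa; have [N0 N0P] := sos_convex_sublevel_bounded cp pa.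
pose N := Num.max 0 N0.
have [|||u _ umin] := @EVT_min_rV R n (mpeval p) [set x | `|x| <= N].
- by exists 0; rewrite /= normr0 /N le_max lexx.
- exact: ball_compact.
- by apply: continuous_subspaceT; exact: mpeval_continuous.
exists u => x; have [x0|x0] := lerP (mpeval p x) (mpeval p 0); last first.
  by apply: le_trans (ltW x0); apply: umin; rewrite inE /= normr0 /N le_max lexx.
have [z rz pz] := const_dirs_reduced p x.
rewrite -pz; apply: umin; rewrite inE /= /N le_max N0P ?orbT //.
by rewrite pz.
Qed.

(** Since a is at most the minimum p(u), the gap p(u) - a is the square of a
    constant. *)
Lemma sos_convex_ge_sos p a : sos_convex p -> (forall x, a <= mpeval p x) ->
  exists s : seq (mpoly n R), p - mpolyC n a = \sum_(h <- s) h ^+ 2.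
Proof.
move=> cp pa; have [u umin] := sos_convex_attains_min cp pa.
have [s sE] := sos_convex_min_sos cp umin.
exists (mpolyC n (Num.sqrt (mpeval p u - a)) :: s).
rewrite big_cons -sE expr2 -mpolyCM -expr2 sqr_sqrtr ?subr_ge0 //.
by rewrite mpolyCB [RHS]addrC addrA subrK.
Qed.

End Attainment.

(** * Separation from a convex cone *)

Section Separation.
Variables (R : realType) (N : nat).
Implicit Types (x y z w b : 'rV[R]_N) (W : set 'rV[R]_N).

Definition dotp x y : R := \sum_k x 0 k * y 0 k.

Lemma dotp_expand x y t : dotp (x + t *: y) (x + t *: y) =
  dotp x x + t * (2%:R * dotp x y + t * dotp y y).
Proof.
rewrite /dotp !mulr_sumr -big_split /= mulr_sumr -big_split /=.
by apply: eq_bigr => k _; rewrite !mxE; ring.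
Qed.

Lemma dotpNl x y : dotp (- x) y = - dotp x y.
Proof. by rewrite /dotp -sumrN; apply: eq_bigr => k _; rewrite mxE mulNr. Qed.

Lemma dotpNr x y : dotp x (- y) = - dotp x y.
Proof. by rewrite /dotp -sumrN; apply: eq_bigr => k _; rewrite mxE mulrN. Qed.

Lemma dotpDr x y z : dotp x (y + z) = dotp x y + dotp x z.
Proof. by rewrite /dotp -big_split; apply: eq_bigr => k _; rewrite mxE mulrDr. Qed.

Lemma dotp_norm x : `|x| ^+ 2 <= dotp x x.
Proof.
have [->|x0] := eqVneq x 0.
  by rewrite normr0 expr0n /= sumr_ge0 // => k _; rewrite -expr2 sqr_ge0.
have /mx_norm_neq0 [[i j] /= xij] : mx_norm x != 0.
  by rewrite -[mx_norm x]/`|x| normr_eq0.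
rewrite [`|x|]xij ord1 real_normK ?num_real // /dotp (bigD1 j) //= expr2 lerDl.
by apply: sumr_ge0 => k _; rewrite -expr2 sqr_ge0.
Qed.

Lemma dotp_shift_continuous b : continuous (fun w => dotp (w - b) (w - b)).
Proof.
rewrite /dotp; apply: continuous_sum => k w.
have ck : {for w, continuous (fun w : 'rV[R]_N => (w - b) 0 k)}.
  rewrite (_ : (fun _ => _) = fun w : 'rV[R]_N => - b 0 k + 1 *: w 0 k).
    apply: (@continuous_comp _ _ _ (fun w : 'rV[R]_N => w 0 k)
      (fun s => - b 0 k + 1 *: (s : R^o))); first exact: coord_continuous.
    exact: continuous_affine.
  by apply/funext => y; rewrite !mxE scale1r addrC.
exact: (continuousM ck ck).
Qed.

(** With p the point of the closed cone nearest to b, the functional b - p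
    works: moving from p in the directions w in W and - p stays in the closed
    cone, which gives (b - p).w <= 0 and (b - p).p >= 0. *)
Lemma cone_separation W b : W 0 -> (forall x y, W x -> W y -> W (x + y)) ->
  (forall t x, 0 <= t -> W x -> W (t *: x)) -> ~ closure W b ->
  exists2 mu, (forall w, W w -> dotp mu w <= 0) & 0 < dotp mu b.
Proof.
move=> W0 WD WZ nWb.
pose dist w := dotp (w - b) (w - b).
pose A := closure W `&` [set w | dist w <= dist 0].
have A0 : A 0 by split => //=; exact: subset_closure.
have cA : compact A.
  apply: bounded_closed_compact; last first.
    apply: closedI; first exact: closed_closure.
    by apply: closed_le; [exact: dotp_shift_continuous|exact: cst_continuous].
  (* As r >= 1, dist 0 <= r ^ 2, so that r bounds the norm of w - b. *)
  pose r := 1 + dist 0; exists (r + `|b|); split; first exact: num_real.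
  move=> M rM w [_ /= wA]; apply: le_trans (ltW rM); rewrite -lerBlDr.
  apply: le_trans (lerB_dist _ _) _.
  have r1 : 1 <= r.
    by rewrite lerDl sumr_ge0 // => k _; rewrite -expr2 sqr_ge0.
  rewrite -(@ler_pXn2r _ 2) ?nnegrE //; last by lra.
  apply: le_trans (dotp_norm _) _; apply: le_trans wA _.
  by rewrite /r in r1 *; nra.
have [||p /[!inE] -[Wp _] pmin] := @EVT_min_rV R N dist A _ cA.
- by exists 0.
- by apply: continuous_subspaceT; exact: dotp_shift_continuous.
have {}pmin w : closure W w -> dist p <= dist w.
  move=> Ww; have [w0|w0] := lerP (dist w) (dist 0).
    by apply: pmin; rewrite inE.
  by apply: le_trans (ltW w0); apply: pmin; rewrite inE.
have first_order w : (forall t, 0 < t <= 1 -> closure W (p + t *: w)) ->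
    0 <= dotp (p - b) w.
  move=> Wt.
  (* Compare dist at p + t w and at p, divide by t and let t tend to 0. *)
  pose r := (- 2%:R * dotp (p - b) w)%:P - (dotp w w)%:P * 'X.
  have rE t : r.[t] = - 2%:R * dotp (p - b) w - dotp w w * t by rewrite /r !hornerE.
  suff : r.[0] <= 0 by rewrite rE mulr0; lra.
  apply: poly_le0_at0 => t t01; rewrite rE.
  have := pmin _ (Wt t t01); rewrite /dist addrAC dotp_expand lerDl.
  by rewrite pmulr_rge0; lra.
exists (b - p).
  move=> w Ww; rewrite -opprB dotpNl oppr_le0; apply: first_order => t /andP[t0 _].
  have := @closure_stable _ W _ (@continuous_affine _ _ (t *: w) 1) _ p Wp.
  rewrite scale1r addrC; apply => x Wx; rewrite scale1r; apply: WD => //.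
  by apply: WZ => //; exact: ltW.
have bp : 0 < `|b - p|.
  by rewrite normr_gt0 subr_eq0; apply/eqP => bp; apply: nWb; rewrite bp.
rewrite -[X in dotp _ X](subrK p) dotpDr ltr_pwDl //.
  by apply: lt_le_trans (dotp_norm _); rewrite exprn_gt0.
rewrite -opprB dotpNl -dotpNr; apply: first_order => t /andP[t0 t1].
have -> : p + t *: - p = (1 - t) *: p by rewrite scalerN scalerBl scale1r.
have := @closure_stable _ W _ (@continuous_affine _ _ 0 (1 - t)) _ p Wp.
rewrite add0r; apply => x Wx; rewrite add0r; apply: WZ => //.
by rewrite subr_ge0.
Qed.

End Separation.

(** * Robust Lagrange duality *)

Section RobustDuality.
Variables (R : realType) (E : lmodType R) (m : nat) (f : E -> R).
Variables (q : 'I_m -> nat) (V : forall i, set 'rV[R]_(q i)).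
Variable (g : forall i, E -> 'rV[R]_(q i) -> R).
Arguments g : clear implicits.
Arguments V : clear implicits.

Hypothesis f_convex : convex_fun f.
Hypothesis V_nonempty : forall i, V i !=set0.
Hypothesis V_convex : forall i v w t, 0 <= t <= 1 -> V i v -> V i w ->
  V i (t *: v + (1 - t) *: w).
Hypothesis g_concave : forall i x, convex_fun (fun v => - g i x v).
Hypothesis g_convex : forall i v, V i v -> convex_fun (g i ^~ v).

Definition robust_feasible x := forall i v, V i v -> g i x v <= 0.

Definition multiplier (lambda : 'I_m -> R) (v : forall i, 'rV[R]_(q i)) :=
  (forall i, 0 <= lambda i) /\ (forall i, V i (v i)).

Definition penalty lambda (v : forall i, 'rV[R]_(q i)) x :=
  \sum_i lambda i * g i x (v i).

(** Downward closure makes this a convex cone, although penalties are only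
    concave in v, and forces separating functionals to be nonnegative. *)
Definition dominated N (X : 'I_N -> E) : set 'rV[R]_N :=
  [set w | exists lambda v, multiplier lambda v /\
    forall k, w 0 k <= penalty lambda v (X k)].

(** Multipliers add up, and v, v' are averaged with weights proportional to
    the multipliers; concavity of g in v gives the inequality. *)
Lemma dominatedD N (X : 'I_N -> E) w w' :
  dominated X w -> dominated X w' -> dominated X (w + w').
Proof.
move=> [l [v [[l0 Vv] wl]]] [l' [v' [[l0' Vv'] wl']]].
pose s i := l i + l' i; pose t i := l i / s i.
have s0 i : 0 <= s i by rewrite addr_ge0.
have t01 i : 0 <= t i <= 1.
  rewrite divr_ge0 //=; have [si|si] := eqVneq (s i) 0.
    by rewrite /t si invr0 mulr0.
  by rewrite ler_pdivrMr ?mul1r ?lerDl // lt_def si s0.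
have st i : s i * t i = l i /\ s i * (1 - t i) = l' i.
  have [si|si] := eqVneq (s i) 0.
    have ll' : l i + l' i = 0 by [].
    by rewrite si !mul0r; have := l0 i; have := l0' i; split; lra.
  have stl : s i * t i = l i by rewrite /t mulrC divfK.
  by split=> //; rewrite mulrBr stl mulr1 /s addrC addKr.
clearbody t; clearbody s.
exists s, (fun i => t i *: v i + (1 - t i) *: v' i); split.
  by split=> // i; apply: V_convex.
move=> k; rewrite mxE; apply: le_trans (lerD (wl k) (wl' k)) _.
rewrite /penalty -big_split /=; apply: ler_sum => i _.
have [{1}<- {1}<-] := st i; rewrite -!mulrA -mulrDr ler_wpM2l //.
by have := @g_concave i (X k) (v i) (v' i) _ (t01 i) => /=; lra.
Qed.

Lemma dominated_basic N (X : 'I_N -> E) i v : V i v ->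
  dominated X (\row_k g i (X k) v).
Proof.
move=> Vv; pose v0 i := sval (cid (V_nonempty i)).
have v0P j : V j (v0 j) by exact: svalP.
exists (fun j => (j == i)%:R), (eqtype.dfwith v0 v); split.
  split=> j; first exact: ler0n.
  by have [<-|ij] := eqVneq i j; rewrite ?dfwith_in ?dfwith_out.
move=> k; rewrite mxE /penalty (bigD1 i) //= big1 => [|j ji].
  by rewrite eqxx mul1r dfwith_in addr0.
by rewrite (negbTE ji) mul0r.
Qed.

Variable a : R.
Hypothesis f_ge : forall x, robust_feasible x -> a <= f x.

(** The slack e keeps the target vector (a - f(X_k))_k away from the closure
    of the cone.  Nonnegativity of the separating functional and its being
    positive on the target allow it to be normalized to weights nu; the
    mean of the X_k is then feasible with value of f at most
    a - sum_k nu_k (a - f(X_k)) < a. *)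
Lemma finite_duality N (X : 'I_N -> E) e : 0 < e ->
  exists lambda v, multiplier lambda v /\
    forall k, a - e <= f (X k) + penalty lambda v (X k).
Proof.
move=> e_gt0; apply: contrapT => nex.
pose b : 'rV[R]_N := \row_k (a - f (X k)).
pose v0 i := sval (cid (V_nonempty i)).
have v0P j : V j (v0 j) by exact: svalP.
have down (w w' : 'rV[R]_N) :
    (forall k, w 0 k <= w' 0 k) -> dominated X w' -> dominated X w.
  move=> ww' [l [v [lv w'l]]]; exists l, v; split=> // k.
  exact: le_trans (ww' k) (w'l k).
have D0 : dominated X 0.
  exists (fun=> 0), v0; split; first by split.
  by move=> k; rewrite mxE /penalty big1 // => i _; rewrite mul0r.
have DZ t (w : 'rV[R]_N) : 0 <= t -> dominated X w -> dominated X (t *: w).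
  move=> t0 [l [v [[l0 Vv] wl]]]; exists (fun i => t * l i), v; split.
    by split=> // i; rewrite mulr_ge0.
  move=> k; rewrite mxE /penalty.
  under eq_bigr do rewrite -mulrA.
  by rewrite -mulr_sumr ler_wpM2l.
have nDb : ~ closure (dominated X) b.
  move=> /(_ (ball b e) (nbhsx_ballx _ _ e_gt0)) [w [[l [v [lv wl]]] bw]].
  apply: nex; exists l, v; split=> // k.
  have : `|b 0 k - w 0 k| < e by exact: (bw.2 0 k).
  by have := wl k; rewrite ltr_norml mxE; lra.
have [mu muD mub] := cone_separation D0 (@dominatedD N X) DZ nDb.
have mu_ge0 k : 0 <= mu 0 k.
  rewrite -oppr_le0; have := muD (- delta_mx 0 k).
  rewrite dotpNr /dotp (bigD1 k) //= big1 => [|j jk].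
    rewrite mxE !eqxx mulr1 addr0; apply; apply: down D0 => j.
    by rewrite !mxE oppr_le0 ler0n.
  by rewrite mxE (negbTE jk) andbF mulr0.
pose s := \sum_k mu 0 k.
have s_gt0 : 0 < s.
  rewrite lt_def sumr_ge0 // andbT; apply/eqP => s0.
  move: mub; rewrite /dotp big1 ?ltxx // => k _.
  by rewrite (psumr_eq0P _ s0) ?mul0r.
pose nu k := mu 0 k / s.
have nu_ge0 k : 0 <= nu k by rewrite divr_ge0 // ltW.
have nu1 : \sum_k nu k = 1 by rewrite -mulr_suml mulfV // gt_eqF.
have nuE (F : 'I_N -> R) : \sum_k nu k * F k = s^-1 * dotp mu (\row_k F k).
  rewrite /dotp mulr_sumr; apply: eq_bigr => k _.
  by rewrite mxE /nu mulrAC mulrC.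
have x_feas : robust_feasible (\sum_k nu k *: X k).
  move=> i v Vv; apply: le_trans (convex_fun_jensen _ (g_convex Vv) nu_ge0 nu1) _.
  rewrite nuE pmulr_rle0 ?invr_gt0 //; apply: muD; exact: dominated_basic.
have := f_ge x_feas; apply/negP; rewrite -ltNge.
apply: le_lt_trans (convex_fun_jensen _ f_convex nu_ge0 nu1) _.
have : 0 < \sum_k nu k * (a - f (X k)) by rewrite nuE mulr_gt0 // invr_gt0.
under eq_bigr do rewrite mulrBr.
by rewrite sumrB -mulr_suml nu1 mul1r subr_gt0.
Qed.

Hypothesis V_compact : forall i, compact (V i).
Variable x0 : E.
Hypothesis slater : forall i v, V i v -> g i x0 v < 0.

Lemma g_continuous i x : continuous (g i x).
Proof.
move=> v; rewrite (_ : g i x = - (fun v => - g i x v)).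
  by apply: continuousN; apply: convex_fun_continuous; exact: g_concave.
by apply/funext => w; rewrite /= opprK.
Qed.

(** At the Slater point all terms of the penalty are nonpositive, and by
    compactness of V_i the i-th one is at most - delta lambda_i for some
    delta > 0. *)
Lemma multiplier_bound i : exists L : R, forall lambda v, multiplier lambda v ->
  a - 1 <= f x0 + penalty lambda v x0 -> lambda i <= L.
Proof.
have [v0 v0V v0max] := @EVT_max_rV R _ (g i x0) (V i) (V_nonempty i) (@V_compact i)
  (continuous_subspaceT (@g_continuous i x0)).
have g0 : 0 < - g i x0 v0 by rewrite oppr_gt0; apply: slater; rewrite -inE.
exists ((f x0 - a + 1) / (- g i x0 v0)) => l v [l0 Vv].
rewrite ler_pdivlMr // /penalty (bigD1 i) //=.
have : \sum_(j < m | j != i) l j * g j x0 (v j) <= 0.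
  by apply: sumr_le0 => j _; rewrite mulr_ge0_le0 // ltW // slater.
have /(ler_wpM2l (l0 i)) : g i x0 (v i) <= g i x0 v0 by apply: v0max; rewrite inE.
lra.
Qed.

(** The filter generated by the approximate solution sets for finitely many
    points and a slack e clusters at an exact solution. *)
Theorem robust_duality : exists lambda v, multiplier lambda v /\
  forall x, a <= f x + penalty lambda v x.
Proof.
have [L LP] := choice multiplier_bound.
pose T i : topologicalType := (R * 'rV[R]_(q i))%type.
pose A : set (prod_topology T) := [set z | forall i, (`[0, L i] `*` V i) (z i)].
have cA : compact A.
  apply: (@tychonoff _ T (fun i => `[0, L i] `*` V i)) => i.
  by apply: compact_setX => //; exact: segment_compact.
pose lag x (z : prod_topology T) :=
  f x + penalty (fun i => (z i).1) (fun i => (z i).2) x.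
have lag_cont x : continuous (lag x).
  have cS : continuous (fun z : prod_topology T => \sum_i (z i).1 * g i x (z i).2).
    apply: continuous_sum => i z.
    have ci : {for z, continuous (proj i : prod_topology T -> T i)}.
      exact: proj_continuous.
    have c1 : {for z, continuous (fun z : prod_topology T => (z i).1 : R)}.
      by apply: (continuous_comp ci); exact: cvg_fst.
    have c2 : {for z, continuous (fun z : prod_topology T => g i x (z i).2)}.
      apply: (@continuous_comp _ _ _ (fun z : prod_topology T => (z i).2) (g i x)).
        by apply: (continuous_comp ci); exact: cvg_snd.
      exact: g_continuous.
    exact: (continuousM c1 c2).
  by move=> z; apply: continuousD (cS z); exact: cst_continuous.
pose B (se : seq E * R) : set (prod_topology T) :=
  A `&` [set z | forall x, x \in se.1 -> a - se.2 <= lag x z].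
pose D : set (seq E * R) := [set se | 0 < se.2].
pose F := filter_from D B.
have PF : ProperFilter F.
  apply: filter_from_proper.
    apply: filter_from_filter; first by exists ([::], 1); exact: ltr01.
    move=> [s e] [s' e'] /= e0 e0'; exists (s ++ s', Num.min e e').
      by rewrite /D /= lt_min e0.
    move=> z [Az zP]; split; split=> // x /= xs.
      have := zP x; rewrite mem_cat xs => /(_ isT); apply: le_trans.
      by rewrite lerB // ge_min lexx.
    have := zP x; rewrite mem_cat xs orbT => /(_ isT); apply: le_trans.
    by rewrite lerB // ge_min lexx orbT.
  move=> [s e] /= e0.
  pose X k := nth 0 (x0 :: s) (val (k : 'I_(size s).+1)).
  (* Slack at most 1 and the Slater point in the list give the bounds L. *)
  have em : 0 < Num.min e 1 by rewrite lt_min e0 ltr01.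
  have [l [v [lv lP]]] := finite_duality X em.
  have lX x : x \in x0 :: s -> a - Num.min e 1 <= f x + penalty l v x.
    move=> xs; have xi : (index x (x0 :: s) < (size s).+1)%N.
      by rewrite -index_mem in xs.
    by have := lP (Ordinal xi); rewrite /X /= nth_index.
  exists (fun i => (l i, v i)); split; last first.
    move=> x xs; apply: le_trans (lX x _); last by rewrite inE xs orbT.
    by rewrite lerB // ge_min lexx.
  move=> i; split=> /=; last exact: lv.2.
  rewrite in_itv /= lv.1 (LP i l v) //.
  apply: le_trans (lX x0 _); last by rewrite inE eqxx.
  by rewrite lerB // ge_min lexx orbT.
have FA : F A by exists ([::], 1); [exact: ltr01|move=> z []].
have [z [Az clz]] := cA F PF FA.
exists (fun i => (z i).1), (fun i => (z i).2); split.
  by split=> i; have [] := Az i; rewrite //= in_itv /= => /andP[].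
move=> x; apply/ler_addgt0Pr => e e0; rewrite -lerBlDr.
have cl : closed [set z | a - e <= lag x z].
  by apply: closed_le => //; exact: cst_continuous.
apply: cl => C Cz; apply: clz => //.
exists ([:: x], e) => // y [_ yP] /=; apply: yP.
by rewrite inE.
Qed.

End RobustDuality.

(** * Exact SOS relaxation *)

Theorem theorem2p3 (R : realType) (n m : nat) (f : mpoly n R)
  (q : 'I_m -> nat) (V : forall i : 'I_m, set 'rV[R]_(q i))
  (g : forall i : 'I_m, 'rV[R]_n -> 'rV[R]_(q i) -> R)
  (d : 'I_m -> nat) (k0 : nat)
  (f_sosconvex : sos_convex f)
  (V_nonempty : forall i, V i !=set0)
  (V_convex : forall i, convex_set (V i))
  (V_compact : forall i, compact (V i))
  (g_concave : forall i (x : 'rV[R]_n), concave_function (g i x))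
  (g_sosconvex : forall i (v : 'rV[R]_(q i)), V i v ->
    exists p : mpoly n R,
      [/\ represents p (fun x => g i x v), sos_convex p & (mpdeg p <= d i)%N])
  (slater : [set x : 'rV[R]_n |
    forall i (v : 'rV[R]_(q i)), V i v -> g i x v < 0] !=set0)
  (k0_even : ~~ odd k0)
  (k0_ge : (maxn (mpdeg f) (\max_(i < m) d i) <= k0)%N)
  (k0_least : forall k : nat, ~~ odd k ->
    (maxn (mpdeg f) (\max_(i < m) d i) <= k)%N -> (k0 <= k)%N) :
  is_ereal_max
    [set mu : R | exists (lambda : 'I_m -> R) (v : forall i, 'rV[R]_(q i)),
      [/\ forall i, 0 <= lambda i, forall i, V i (v i) &
        exists2 p : mpoly n R, Sigma2 k0 p &
          represents p
            (fun x => mpeval f x + \sum_(i < m) lambda i * g i x (v i) - mu)]]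
    (ereal_inf [set (mpeval f x)%:E | x in
      [set x : 'rV[R]_n |
        forall i (v : 'rV[R]_(q i)), V i v -> g i x v <= 0]]).
Proof.
set A := [set mu | _]; set I := ereal_inf _.
have [x0 x0P] := slater.
have weak mu x : A mu -> (forall i v, V i v -> g i x v <= 0) -> mu <= mpeval f x.
  move=> [l [v [l0 Vv [p [_ [s ps]] pE]]]] xF.
  have : 0 <= mpeval p x by rewrite ps mpeval_sos_ge0.
  rewrite -pE; have : \sum_(i < m) l i * g i x (v i) <= 0; last by lra.
  by apply: sumr_le0 => i _; rewrite mulr_ge0_le0 // xF.
have strong a :
    (forall x, (forall i v, V i v -> g i x v <= 0) -> a <= mpeval f x) -> A a.
  move=> aP.
  have f_cvx : convex_fun (mpeval f : 'rV[R]_n -> R).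
    exact: sos_convex_convex_fun.
  have V_cvx i (v w : 'rV[R]_(q i)) t : 0 <= t <= 1 -> V i v -> V i w ->
      V i (t *: v + (1 - t) *: w).
    move=> /andP[t0 t1] Vv Vw; apply: set_mem.
    by apply: (V_convex i v w (Itv01 t0 t1)); exact: mem_set.
  have g_ccv i x : convex_fun (fun v => - g i x v).
    move=> v w t /andP[t0 t1].
    by apply: (g_concave i x (Itv01 t0 t1)); exact: in_setT.
  have g_cvx i v : V i v -> convex_fun (g i ^~ v).
    move=> /g_sosconvex [p [pE cp _]] x y t t01.
    by rewrite !pE; exact: sos_convex_convex_fun.
  have [l [v [[l0 Vv] lv]]] :=
    robust_duality f_cvx V_nonempty V_cvx g_ccv g_cvx aP V_compact x0P.
  have [p pP] := choice (fun i => g_sosconvex i (v i) (Vv i)).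
  pose L := f + \sum_i l i *: p i.
  have LE x : mpeval L x = mpeval f x + \sum_i l i * g i x (v i).
    rewrite /L /mpeval mevalD rmorph_sum /=; congr (_ + _); apply: eq_bigr => i _.
    by have [pE _ _] := pP i; rewrite mevalZ pE.
  have cL : sos_convex L.
    by apply: sos_convex_comb => // i; have [] := pP i.
  have [s sE] : exists s : seq (mpoly n R), L - mpolyC n a = \sum_(h <- s) h ^+ 2.
    by apply: sos_convex_ge_sos => // x; rewrite LE.
  exists l, v; split=> //; exists (L - mpolyC n a); last first.
    by move=> x; rewrite [RHS]/mpeval mevalB mevalC -/(mpeval L x) LE.
  split; last by exists s.
  move: k0_ge; rewrite geq_max => /andP[fk /bigmax_leqP dk].
  rewrite -mpolyCN; apply: mpdegD; last exact: mpdegC.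
  apply: mpdeg_comb => // i; have [_ _ pd] := pP i.
  by apply: leq_trans pd _; exact: dk.
have supI : (ereal_sup (EFin @` A) <= I)%E.
  apply: ge_ereal_sup => _ [mu Amu <-]; apply: le_ereal_inf_tmp => _ [x xF <-].
  by rewrite lee_fin; exact: weak.
have Ix0 : (I <= (mpeval f x0)%:E)%E.
  by apply: ereal_inf_lbound; exists x0 => // i v Vv; apply: ltW; exact: x0P.
have attained a : I = a%:E -> A a.
  move=> Ia; apply: strong => x xF; rewrite -lee_fin -Ia.
  by apply: ereal_inf_lbound; exists x.
split=> //; apply/eqP; rewrite eq_le supI andbT.
clear supI; case: I Ix0 attained => [a _ Aa||_ _]; last by rewrite leNye.
  by apply: ereal_sup_ubound; exists a => //; exact: Aa.
by rewrite leye_eq.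
Qed.
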